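(* Let $K$ be an arbitrary field, let $n>2$, and let $G=\operatorname{Aut}_0(K[x_1,\dots,x_n])$. Then $G$ cannot be isomorphic to any subgroup $H$ of $\operatorname{Aut}(K\langle x_1,\dots,x_n\rangle)$ via the natural abelianization; that is, there is no subgroup $H\subset\operatorname{Aut}(K\langle x_1,\dots,x_n\rangle)$ such that the natural abelianization homomorphism $\operatorname{Aut}(K\langle x_1,\dots,x_n\rangle)\to\operatorname{Aut}(K[x_1,\dots,x_n])$ restricts to an isomorphism of $H$ onto $G$. The same is true with $G$ replaced by $\operatorname{NAut}(K[x_1,\dots,x_n])$.
   Context: The natural abelianization $\operatorname{Aut}(K\langle x_1,\dots,x_n\rangle)\to\operatorname{Aut}(K[x_1,\dots,x_n])$ is induced by the projection of the free associative algebra onto its quotient by the commutator ideal. $\operatorname{Aut}_0(K[x_1,\dots,x_n])$ is the group of $K$-algebra automorphisms preserving the origin, i.e. mapping the augmentation ideal $(x_1,\dots,x_n)$ into itself. $\operatorname{TAut}(K[x_1,\dots,x_n])$ is the group generated by linear automorphisms and elementary automorphisms $x_i\mapsto x_i+P$, $x_j\mapsto x_j$ ($j\ne i$), $P$ independent of $x_i$. An automorphism $\varphi$ of $K[x_1,\dots,x_n]$ is nice if for every $m$ there are $\psi_m\in\operatorname{Aut}(K[x_1,\dots,x_n])$ and $\phi_m\in\operatorname{TAut}(K[x_1,\dots,x_n])$ with $\varphi=\psi_m\phi_m$ and $\psi_m(x_i)\equiv x_i\bmod (x_1,\dots,x_n)^m$ for all $i$; $\operatorname{NAut}(K[x_1,\dots,x_n])$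 is the group of nice automorphisms. *)

(* Defs.v *)
From HB Require Import structures.
From mathcomp Require Import all_boot all_order all_algebra.
From mathcomp Require Import boolp classical_sets functions.
From mathcomp Require Import -(notations) monalg.
From mathcomp Require Import mpoly.

Set Implicit Arguments.
Unset Strict Implicit.
Unset Printing Implicit Defensive.

Import GRing.Theory.
Local Open Scope ring_scope.

Definition is_alg_aut (K : fieldType) (A : lalgType K) (f : A -> A) : Prop :=
  [/\ linear f, monoid_morphism f & bijective f].

Record Aut (K : fieldType) (A : lalgType K) := MkAut {
  aut_val :> A -> A;
  aut_valP : `[< is_alg_aut aut_val >] }.

HB.instance Definition _ (K : fieldType) (A : lalgType K) :=
  [isSub for @aut_val K A].
HB.instance Definition _ (K : fieldType) (A : lalgType K) :=
  [Choice of Aut A by <:].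

Section AutGroup.
Context (K : fieldType) (A : lalgType K).
Implicit Types f g h : Aut A.

Lemma autP f g : f =1 g -> f = g.
Proof. by move=> fg; apply/val_inj/funext. Qed.

Lemma aut_is_aut f : is_alg_aut f.
Proof. by case: f => f /= /asboolP. Qed.

Fact aut_is_linear f : linear f. Proof. by case: (aut_is_aut f). Qed.
Fact aut_is_monoid_morphism f : monoid_morphism f.
Proof. by case: (aut_is_aut f). Qed.
Lemma aut_bij f : bijective f. Proof. by case: (aut_is_aut f). Qed.

HB.instance Definition _ f :=
  GRing.isLinear.Build K A A *:%R (aut_val f) (@aut_is_linear f).
HB.instance Definition _ f :=
  GRing.isMonoidMorphism.Build A A (aut_val f) (@aut_is_monoid_morphism f).

Fact aut_one_subproof : `[< is_alg_aut (@id A) >].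
Proof. by apply/asboolP; split => //; exists id. Qed.
Definition aut_one : Aut A := MkAut aut_one_subproof.

Fact aut_mul_subproof f g : `[< is_alg_aut (f \o g) >].
Proof.
apply/asboolP; split; first exact: linearP.
  by split; [exact: rmorph1 | exact: rmorphM].
exact: bij_comp (aut_bij f) (aut_bij g).
Qed.
Definition aut_mul f g : Aut A := MkAut (aut_mul_subproof f g).

Fact aut_inv_ex f : exists g : A -> A, cancel f g /\ cancel g f.
Proof. by case: (aut_bij f) => g; exists g. Qed.
Definition aut_inv_fun f : A -> A := projT1 (cid (aut_inv_ex f)).
Lemma aut_invK f : cancel f (aut_inv_fun f).
Proof. by rewrite /aut_inv_fun; case: cid => g []. Qed.
Lemma aut_invVK f : cancel (aut_inv_fun f) f.
Proof. by rewrite /aut_inv_fun; case: cid => g []. Qed.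

Fact aut_inv_subproof f : `[< is_alg_aut (aut_inv_fun f) >].
Proof.
have fI := can_inj (aut_invK f); apply/asboolP; split.
- by move=> a x y; apply: fI; rewrite linearP /= !aut_invVK.
- split; first by apply: fI; rewrite aut_invVK rmorph1.
  by move=> x y; apply: fI; rewrite rmorphM /= !aut_invVK.
- exact: Bijective (aut_invVK f) (aut_invK f).
Qed.
Definition aut_inv f : Aut A := MkAut (aut_inv_subproof f).

Fact aut_mulA : associative aut_mul. Proof. by move=> f g h; apply: autP. Qed.
Fact aut_1mul : left_id aut_one aut_mul. Proof. by move=> f; apply: autP. Qed.
Fact aut_mul1 : right_id aut_one aut_mul. Proof. by move=> f; apply: autP. Qed.
Fact aut_Vmul : left_inverse aut_one aut_inv aut_mul.
Proof. by move=> f; apply: autP => x; apply: aut_invK. Qed.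
Fact aut_mulV : right_inverse aut_one aut_inv aut_mul.
Proof. by move=> f; apply: autP => x; apply: aut_invVK. Qed.

HB.instance Definition _ := isGroup.Build (Aut A)
  aut_mulA aut_1mul aut_mul1 aut_Vmul aut_mulV.

Lemma autME f g x : (f * g)%g x = f (g x). Proof. by []. Qed.
Lemma aut1E x : (1%g : Aut A) x = x. Proof. by []. Qed.
End AutGroup.

Definition is_subgroup (G : groupType) (H : set G) : Prop :=
  group_closed (mem H).

(* K<x_1, .., x_n>, as the monoid algebra of the free monoid on 'I_n. *)
Notation free_alg K n := (malg (fmonom 'I_n) K).

Section Abelianization.
Context (K : fieldType) (n : nat).
Local Notation F := (free_alg K n).
Local Notation P := {mpoly K[n]}.

Definition free_var (i : 'I_n) : F := mkmalgU (fmu i) 1.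

Definition word_mon (w : fmonom 'I_n) : P := \prod_(i <- (w : seq 'I_n)) 'X_i.

Fact word_mon_is_mmorphism : mmorphism word_mon.
Proof.
by split; [move=> v w; rewrite /word_mon fmM big_cat
          |rewrite /word_mon fm1 big_nil].
Qed.
HB.instance Definition _ :=
  monalg.isMultiplicative.Build _ P word_mon word_mon_is_mmorphism.

(* The projection of the free algebra onto its quotient by the commutator
   ideal, the quotient being identified with K[x_1, .., x_n]. *)
Definition comm_proj : F -> P := monalg.mmap (@mpolyC n K) word_mon.
HB.instance Definition _ := GRing.RMorphism.on comm_proj.

Fact comm_proj_is_scalable : scalable comm_proj.
Proof. by move=> c a; rewrite /comm_proj monalg.mmapZ mul_mpolyC. Qed.
HB.instance Definition _ :=
  GRing.isScalable.Build K F P *:%R comm_proj comm_proj_is_scalable.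

Lemma comm_proj_var i : comm_proj (free_var i) = 'X_i.
Proof.
by rewrite /comm_proj monalg.mmapU /= rmorph1 mul1r /word_mon fmU big_seq1.
Qed.

Lemma free_word (w : fmonom 'I_n) :
  mkmalgU w 1 = \prod_(i <- (w : seq 'I_n)) free_var i :> F.
Proof.
case: w => s; elim: s => [|i s IH] /=.
  by rewrite big_nil -fmoneE.
rewrite big_cons -IH /free_var malgM_def fgmulUU mulr1; congr mkmalgU.
by apply/eqP; rewrite fmP fmM fmU.
Qed.

Lemma free_alg_ext (B : lalgType K) (f g : {lrmorphism F -> B}) :
  (forall i, f (free_var i) = g (free_var i)) -> f =1 g.
Proof.
move=> fg a; rewrite (monalgE a) !raddf_sum; apply: eq_bigr => w _ /=.
have -> : mkmalgU w (monalg.mcoeff w a) = monalg.mcoeff w a *: mkmalgU w 1 :> F.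
  by apply/malgP => v; rewrite monalg.mcoeffZ !mcoeffU mulrnAr mulr1.
rewrite !linearZ /= free_word !rmorph_prod; congr (_ *: _).
by apply: eq_bigr => i _; apply: fg.
Qed.

(* The endomorphism of K[x_1, .., x_n] induced by [phi], determined by
   [abel_fun_proj] below. *)
Definition abel_fun (phi : Aut F) : P -> P :=
  comp_mpoly [tuple comm_proj (phi (free_var i)) | i < n].
HB.instance Definition _ phi := GRing.LRMorphism.on (abel_fun phi).

Lemma abel_fun_proj phi a : abel_fun phi (comm_proj a) = comm_proj (phi a).
Proof.
apply: (@free_alg_ext P (abel_fun phi \o comm_proj) (comm_proj \o phi)) => i /=.
by rewrite comm_proj_var /abel_fun comp_mpolyXU -tnth_nth tnth_mktuple.
Qed.

Lemma comm_proj_surj p : exists a, comm_proj a = p.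
Proof.
exists (\sum_(m <- msupp p) p@_m *: \prod_(i < n) free_var i ^+ m i).
rewrite [RHS]mpolyE raddf_sum; apply: eq_bigr => m _ /=.
rewrite linearZ /= rmorph_prod mpolyXE_id; congr (_ *: _).
by apply: eq_bigr => i _; rewrite rmorphXn /= comm_proj_var.
Qed.

Fact abel_fun_can phi psi : (psi * phi = 1)%g ->
  cancel (abel_fun phi) (abel_fun psi).
Proof.
move=> psiK p; have [a <-] := comm_proj_surj p.
by rewrite !abel_fun_proj -autME psiK.
Qed.

Fact abel_subproof phi : `[< is_alg_aut (abel_fun phi) >].
Proof.
apply/asboolP; split; first exact: linearP.
  by split; [exact: rmorph1 | exact: rmorphM].
by apply: (@Bijective _ _ _ (abel_fun phi^-1%g)); apply: abel_fun_can;
   rewrite ?mulgV ?mulVg.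
Qed.

Definition abel (phi : Aut F) : Aut P := MkAut (abel_subproof phi).

Lemma abel_proj phi a : abel phi (comm_proj a) = comm_proj (phi a).
Proof. exact: abel_fun_proj. Qed.

Fact abel_is_group_morphism : {morph abel : phi psi / (phi / psi)%g}.
Proof.
have abelM : {morph abel : phi psi / (phi * psi)%g}.
  move=> phi psi; apply: autP => p; have [a <-] := comm_proj_surj p.
  by rewrite autME !abel_proj autME.
move=> phi psi; apply: (mulIg (abel psi)).
by rewrite -abelM !mulgVK.
Qed.
HB.instance Definition _ :=
  isGroupMorphism.Build (Aut F) (Aut P) abel abel_is_group_morphism.
End Abelianization.

Section PolynomialAutomorphisms.
Context (K : fieldType) (n : nat).
Local Notation P := {mpoly K[n]}.
Implicit Types phi psi : Aut P.

(* The ideal (x_1, .., x_n)^m, generated by the products of m variables. *)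
Definition aug_pow (m : nat) : set P := [set p | exists c : m.-tuple 'I_n -> P,
  p = \sum_(t : m.-tuple 'I_n) c t * \prod_(i <- t) 'X_i].

Definition Aut0 : set (Aut P) :=
  [set phi | forall p, aug_pow 1 p -> aug_pow 1 (phi p)].

Definition linear_aut : set (Aut P) := [set phi | exists A : 'M[K]_n,
  forall i, phi 'X_i = \sum_j A i j *: 'X_j].

Definition independent_of (i : 'I_n) (p : P) : Prop :=
  forall m, m \in msupp p -> m i = 0%N.

Definition elementary_aut : set (Aut P) := [set phi | exists i p,
  [/\ independent_of i p, phi 'X_i = 'X_i + p
    & forall j, j != i -> phi 'X_j = 'X_j]].

Definition TAut : set (Aut P) :=
  smallest (@is_subgroup (Aut P)) (linear_aut `|` elementary_aut).

(* The product psi * tau of algebra automorphisms is the composite psi \o tau. *)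
Definition NAut : set (Aut P) := [set phi | forall m : nat,
  exists psi tau, [/\ phi = (psi * tau)%g, TAut tau
    & forall i, aug_pow m (psi 'X_i - 'X_i)]].
End PolynomialAutomorphisms.

(* Main.v *)
Require Import Defs.
From HB Require Import structures.
From mathcomp Require Import all_boot all_order all_algebra.
From mathcomp Require Import boolp classical_sets functions.
From mathcomp Require Import -(notations) finmap.
From mathcomp Require Import -(notations) monalg.
From mathcomp Require Import mpoly.
From mathcomp Require Import perm ring.

(* Only the terms of low degree of the lifts matter.  Let I be the augmentation
   ideal of the free algebra and suppose that the linear and the elementary
   automorphisms of K[x_1, .., x_n] lift compatibly with their relations.
   If a lift g is the identity modulo I^2, its quadratic part is equivariant
   under every linear automorphism commuting with the image of g.

   The automorphism z -> z + xy commutes with the swap of x and y, so the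
   coefficients of xy and yx in the image of z under its lift are equal; their
   sum is 1, hence 2 is invertible in K.

   When 2 is invertible, commutation with sign changes and with a transvection
   forces the lift of x_p -> x_p + x_q^2 to have quadratic part exactly x_q^2.
   Commutators of such lifts are the identity modulo I^3, and their cubic parts
   are commutators of derivations: the map T : z -> z + 4 x^2 y is the quotient
   of two of these commutators and its lift has cubic part 2 (x^2 y + y x^2).
   Write t : x -> x + y and s for the swap of x and y.  Then
     t T t^-1 = (t^-1 T t) (s T s^-1)^4,
   by the identity (x + y)^2 y = (x - y)^2 y + 4 y^2 x, but the cubic parts of
   the lifts satisfy the same relation only if 4 = 0: compare the coefficients
   of xyy. *)

Set Implicit Arguments.
Unset Strict Implicit.
Unset Printing Implicit Defensive.

Import GRing.Theory.
Local Open Scope ring_scope.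

(** * Words and powers of the augmentation ideal *)

Definition commut (G : groupType) (f g : G) : G := (f * g * f^-1 * g^-1)%g.

Lemma autKV (K : fieldType) (A : lalgType K) (f : Aut A) a : f (f^-1%g a) = a.
Proof. by rewrite -autME mulgV. Qed.

Lemma autVK (K : fieldType) (A : lalgType K) (f : Aut A) a : f^-1%g (f a) = a.
Proof. by rewrite -autME mulVg. Qed.

Lemma autD (K : fieldType) (A : lalgType K) (f : Aut A) :
  {morph f : a b / a + b}.
Proof. exact: linearD. Qed.

Lemma autN (K : fieldType) (A : lalgType K) (f : Aut A) :
  {morph f : a / - a}.
Proof. exact: linearN. Qed.

Lemma autM (K : fieldType) (A : lalgType K) (f : Aut A) :
  {morph f : a b / a * b}.
Proof. exact: rmorphM. Qed.

Lemma autZ (K : fieldType) (A : lalgType K) (f : Aut A) (e : K) :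
  {morph f : a / e *: a}.
Proof. exact: linearZ. Qed.

Section Words.
Context (K : fieldType) (n : nat) (A : lalgType K).
Context (x_ : 'I_n -> A) (cf : seq 'I_n -> {scalar A}).
Implicit Types (a b c : A) (s t : seq 'I_n) (k d : nat) (f g h : Aut A).

Definition word s : A := \prod_(i <- s) x_ i.

(* An abstract presentation of the free algebra on the [x_ i], in which [cf s a]
   is the coefficient of the word [s] in [a]. *)
Record word_basis : Prop := WordBasis {
  word_expansion : forall a, exists r : seq (seq 'I_n),
    a = \sum_(s <- r) cf s a *: word s;
  cf_word : forall s t, cf s (word t) = (s == t)%:R;
  word_scalerAr : forall (e : K) a b, e *: (a * b) = a * (e *: b) }.

Context (wb : word_basis).

Lemma word1 : word [::] = 1. Proof. by rewrite /word big_nil. Qed.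

Lemma word_cons i s : word (i :: s) = x_ i * word s.
Proof. by rewrite /word big_cons. Qed.

Lemma word_var i : word [:: i] = x_ i. Proof. by rewrite /word big_seq1. Qed.

Lemma cf_var s i : cf s (x_ i) = (s == [:: i])%:R.
Proof. by rewrite -(cf_word wb) word_var. Qed.

Lemma cf_ext a b : (forall s, cf s a = cf s b) -> a = b.
Proof.
move=> ab; apply/eqP; rewrite -subr_eq0; apply/eqP.
have [r ->] := word_expansion wb (a - b).
by rewrite big1 // => s _; rewrite linearB /= ab subrr scale0r.
Qed.

Lemma supp_ind (Q : A -> Prop) a :
  (forall (e : K) a b, Q a -> Q b -> Q (e *: a + b)) -> Q 0 ->
  (forall s, cf s a != 0 -> Q (word s)) -> Q a.
Proof.
move=> QL Q0 Qw; have [r ->] := word_expansion wb a.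
elim/big_rec: _ => // s b _ Qb; have [->|sa] := eqVneq (cf s a) 0.
  by rewrite scale0r add0r.
by apply: QL => //; apply: Qw.
Qed.

Lemma word_ind (Q : A -> Prop) :
  (forall (e : K) a b, Q a -> Q b -> Q (e *: a + b)) -> Q 0 ->
  (forall s, Q (word s)) -> forall a, Q a.
Proof. by move=> QL Q0 Qw a; apply: supp_ind. Qed.

(** A word factors into two words exactly along its cuts; [k] runs up to [size s] because both parts
    may be empty. *)
Lemma cfM s a b :
  cf s (a * b) =
  \sum_(k < (size s).+1) cf (take k s) a * cf (drop k s) b.
Proof.
(* Multiplying by one variable on the left consumes the first letter; the general rule follows by
   induction on the words of the left factor. *)
have cfMx i c t : cf t (x_ i * c) =
    if t is j :: t' then (i == j)%:R * cf t' c else 0.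
  elim/word_ind: c t => [e c c' IH IH' t|t|u t].
  - rewrite mulrDr -(word_scalerAr wb) linearP /= IH IH'.
    by case: t => [|j t]; rewrite ?linearP /= ?mulr0 ?addr0 //; ring.
  - by rewrite mulr0 linear0; case: t => [|j t] //; rewrite linear0 mulr0.
  rewrite -word_cons.
  case: t => [|j t]; rewrite !(cf_word wb) // eqseq_cons -natrM mulnb.
  by rewrite [j == i]eq_sym.
elim/word_ind: a s => [e a a' Ha Ha' s|s|u].
- rewrite mulrDl -scalerAl linearP /= Ha Ha' mulr_sumr -big_split /=.
  by apply: eq_bigr => k _; rewrite linearP /=; ring.
- by rewrite mul0r linear0 big1 // => k _; rewrite linear0 mul0r.
elim: u => [|i u IH] s.
  rewrite word1 mul1r big_ord_recl take0 drop0.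
  rewrite -word1 (cf_word wb) mul1r.
  rewrite big1 ?addr0 // => k _; rewrite (cf_word wb) /=.
  by case: s k => [[]//|j s k] /=; rewrite mul0r.
rewrite word_cons -mulrA cfMx big_ord_recl take0 cfMx mul0r add0r.
case: s => [|j s]; first by rewrite big_ord0.
rewrite IH mulr_sumr; apply: eq_bigr => k _ /=.
by rewrite cfMx mulrA.
Qed.

(* [low k a]: [a] lies in the k-th power of the augmentation ideal. *)
Definition low k a := forall s, (size s < k)%N -> cf s a = 0.

Lemma low_word s k : (k <= size s)%N -> low k (word s).
Proof.
move=> ks t tk; rewrite (cf_word wb); case: eqP => // ts.
by move: ks; rewrite -ts leqNgt tk.
Qed.

Lemma low_var i : low 1 (x_ i).
Proof. by rewrite -word_var; apply: low_word. Qed.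

Lemma low_0 k : low k 0. Proof. by move=> s _; rewrite linear0. Qed.

Lemma low_le k d a : (k <= d)%N -> low d a -> low k a.
Proof. by move=> kd da s sk; apply: da; apply: leq_trans kd. Qed.

Lemma lowD k a b : low k a -> low k b -> low k (a + b).
Proof. by move=> la lb s sk; rewrite linearD /= la // lb // addr0. Qed.

Lemma lowN k a : low k a -> low k (- a).
Proof. by move=> la s sk; rewrite linearN /= la // oppr0. Qed.

Lemma lowB k a b : low k a -> low k b -> low k (a - b).
Proof. by move=> la lb; apply: lowD => //; apply: lowN. Qed.

Lemma lowZ k (e : K) a : low k a -> low k (e *: a).
Proof. by move=> la s sk; rewrite linearZ /= la // mulr0. Qed.

Lemma lowM k d a b : low k a -> low d b -> low (k + d) (a * b).
Proof.
move=> la lb s sk; rewrite cfM big1 // => i _.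
have [ik|ki] := ltnP i k.
  rewrite la ?mul0r // size_take; case: ifP => // h.
  by apply: leq_ltn_trans ik; rewrite leqNgt h.
rewrite lb ?mulr0 // size_drop ltn_subLR; last by rewrite -ltnS.
by apply: leq_trans sk _; rewrite leq_add2r.
Qed.

Lemma low_ind (Q : A -> Prop) k a : low k a ->
  (forall (e : K) a b, Q a -> Q b -> Q (e *: a + b)) -> Q 0 ->
  (forall s, (k <= size s)%N -> Q (word s)) -> Q a.
Proof.
move=> la QL Q0 Qw; apply: supp_ind => // s sa; apply: Qw.
by rewrite leqNgt; apply/negP => /la /eqP; rewrite (negbTE sa).
Qed.

(** Only the cut after [s] survives: an earlier one leaves a prefix too short for [a], a later one a
    suffix too short for [b]. *)
Lemma cfM_low k d s t a b : low k a -> low d b -> size s = k -> size t = d ->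
  cf (s ++ t) (a * b) = cf s a * cf t b.
Proof.
move=> la lb sk td; rewrite cfM.
have ks : (k < (size (s ++ t)).+1)%N by rewrite size_cat sk ltnS leq_addr.
rewrite (bigD1 (Ordinal ks)) //= big1 ?addr0 => [|[i hi]].
  by rewrite -sk take_size_cat // drop_size_cat.
rewrite -val_eqE /= neq_ltn => /orP[ik|ki].
  rewrite la ?mul0r // size_take; case: ifP => // h.
  by apply: leq_ltn_trans ik; rewrite leqNgt h.
rewrite lb ?mulr0 // size_drop size_cat sk td ltn_subLR.
  by rewrite ltn_add2r.
by move: hi; rewrite size_cat sk td ltnS.
Qed.

Lemma lowB_trans k a b c : low k (a - b) -> low k (b - c) -> low k (a - c).
Proof. by move=> ab bc; rewrite -(subrKA b); apply: lowD. Qed.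

Lemma low_cf k s a b : low k (a - b) -> (size s < k)%N -> cf s a = cf s b.
Proof. by move=> ab sk; apply/eqP; rewrite -subr_eq0 -linearB /= ab. Qed.

Lemma low_quad a : low 2 a ->
  low 3 (a - \sum_i \sum_j cf [:: i; j] a *: (x_ i * x_ j)).
Proof.
move=> la s; rewrite ltnS leq_eqVlt => /orP[|s2]; last first.
  rewrite linearB /= la // sub0r raddf_sum /= big1 ?oppr0 // => i _.
  rewrite raddf_sum /= big1 // => j _; rewrite linearZ /=.
  by rewrite (@lowM 1 1) ?mulr0 //; exact: low_var.
case: s => [|u [|v []]] // _; rewrite linearB /= raddf_sum /=.
rewrite (bigD1 u) //= raddf_sum /= (bigD1 v) //= !linearZ /=.
have E i j : cf [:: u; v] (x_ i * x_ j) = ((u == i) && (v == j))%:R.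
  by rewrite (@cfM_low 1 1 [:: u] [:: v]) ?cf_var ?eqseq_cons ?andbT
    -?natrM ?mulnb //;
     exact: low_var.
rewrite E !eqxx mulr1 big1 => [|j /negbTE jv]; last first.
  by rewrite linearZ /= E andbC eq_sym jv mulr0.
rewrite big1 ?addr0 ?subrr // => i /negbTE iu.
by rewrite raddf_sum /= big1 // => j _; rewrite linearZ /= E eq_sym iu mulr0.
Qed.

(* [ring] needs commutativity, so additive identities in [A] are checked on
   coefficients. *)
Ltac coefwise := apply: cf_ext => ?;
  rewrite ?(linearD, linearN, linearZ, linear0) /=; ring.

(** * Automorphisms that are the identity modulo a power of the ideal *)

(** On the variables this means being the identity modulo the power d + 1 of the ideal, which
    suffices by [rises_var]. In particular [rises 0] says that [f] preserves the filtration. *)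
Definition rises d f := forall k a, low k a -> low (k + d) (f a - a).

Lemma rises_le d e f : (d <= e)%N -> rises e f -> rises d f.
Proof. by move=> de fe k a /fe; apply: low_le; rewrite leq_add2l. Qed.

Lemma rises0 d f : rises d f -> rises 0 f.
Proof. exact: rises_le. Qed.

Lemma rises_low d f k a : rises d f -> low k a -> low k (f a).
Proof.
move=> /rises0 fd ka; rewrite -(subrK a (f a)); apply: lowD => //.
by rewrite -[k]addn0; apply: fd.
Qed.

(** Telescoping along a word: f (x w) - x w = (f x - x) f w + x (f w - w), and both terms gain d
    degrees. *)
Lemma rises_var d f : (forall i, low d.+1 (f (x_ i) - x_ i)) -> rises d f.
Proof.
move=> fd; have fw s : low (size s + d) (f (word s) - word s).
  elim: s => [|i s IH]; first by rewrite word1 rmorph1 subrr; apply: low_0.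
  have -> : word (i :: s) = x_ i * word s by rewrite word_cons.
  rewrite rmorphM /= [_ - _](_ : _ =
    (f (x_ i) - x_ i) * f (word s) + x_ i * (f (word s) - word s)).
    apply: lowD.
      rewrite addnC; apply: low_le (lowM (fd i) (_ : low (size s) _)).
        by rewrite addnS addSn.
      rewrite -(subrK (word s) (f _)); apply: lowD; last exact: low_word.
      by apply: low_le IH; rewrite leq_addr.
    exact: lowM (@low_var i) IH.
  by rewrite mulrBl mulrBr addrA subrK.
move=> k a ka; apply: (@low_ind (fun a => low (k + d) (f a - a)) _ _ ka)
  => [e b c IHb IHc||s ks].
- rewrite linearP /= opprD addrACA -scalerBr.
  by apply: lowD => //; apply: lowZ.
- by rewrite linear0 subrr; apply: low_0.
- by apply: low_le (fw s); rewrite leq_add2r.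
Qed.

Lemma risesM d f g : rises d f -> rises d g -> rises d (f * g)%g.
Proof.
move=> fd gd k a ka; rewrite autME; apply: (@lowB_trans _ _ (g a)).
  by apply: fd; apply: rises_low gd ka.
exact: gd.
Qed.

Lemma rises0V f : rises 0 f -> rises 0 f^-1%g.
Proof.
move=> f0; apply: rises_var => i; apply: lowB; last exact: low_var.
set a := f^-1%g (x_ i).
(* Let c be the constant term of [a]. As [f] fixes scalars and preserves the ideal, f (a - c) = x_i
   - c has no constant term, so c = 0. *)
have a0 : cf [::] a = 0.
  have /(rises_low f0) : low 1 (a - (cf [::] a)%:A).
    case=> // _; rewrite linearB linearZ /=.
    rewrite -word1.
    by rewrite (cf_word wb) mulr1 subrr.
  rewrite linearB linearZ /= rmorph1 autKV => /(_ [::] isT).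
  rewrite linearB linearZ /= cf_var sub0r.
  rewrite -word1.
  by rewrite (cf_word wb) mulr1 => /eqP; rewrite oppr_eq0 => /eqP.
by case.
Qed.

Lemma risesV d f : rises d f -> rises d f^-1%g.
Proof.
move=> fd k a ka; have f0 := rises0V (rises0 fd).
rewrite -opprB; apply: lowN; rewrite -{1}(autKV f a).
by apply: fd; apply: rises_low f0 ka.
Qed.

Lemma rises_conj d f g : rises 0 f -> rises d g -> rises d (f * g * f^-1)%g.
Proof.
move=> f0 gd k a ka; rewrite !autME -{2}(autKV f a) -linearB /=.
apply: (rises_low f0); apply: gd.
by apply: rises_low (rises0V f0) ka.
Qed.

(** The exact error is f u - u for u = g a - a, and u has already gained d degrees. *)
Lemma risesM_approx d f g k a : rises d f -> rises d g -> low k a ->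
  low (k + d + d) ((f * g)%g a - a - ((f a - a) + (g a - a))).
Proof.
move=> fd gd ka; rewrite autME.
rewrite [X in low _ X](_ : _ = f (g a - a) - (g a - a)).
  by apply: fd; apply: gd.
by rewrite linearB /=; coefwise.
Qed.

Lemma risesV_approx d f k a : rises d f -> low k a ->
  low (k + d + d) (f^-1%g a - a + (f a - a)).
Proof.
move=> fd ka; have := lowN (fd _ _ (risesV fd ka)).
by rewrite [f (_ - _)]linearB /= autKV; congr low; coefwise.
Qed.

(** Evaluating at [g (f a)] removes the inverses: both sides are f (g a) - g (f a), the right one
    written as the commutator of f - 1 and g - 1 applied to a. *)
Lemma commut_defect f g a :
  commut f g (g (f a)) - g (f a) =
  (f (g a - a) - (g a - a)) - (g (f a - a) - (f a - a)).
Proof. by rewrite /commut !autME !autVK !linearB /=; coefwise. Qed.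

Lemma rises_comm d f g : rises d f -> rises d g -> rises (d + d) (commut f g).
Proof.
move=> fd gd k a ka; pose b := (g * f)^-1%g a.
have kb : low k b by apply: rises_low (risesV (risesM gd fd)) ka.
have -> : a = g (f b) by rewrite -autME autKV.
rewrite commut_defect addnA.
by apply: lowB; [apply: fd; apply: gd|apply: gd; apply: fd].
Qed.

(** Passing from [g (f a)] to [a] changes the argument by an element that has gained d degrees, on
    which the commutator gains 2d more. *)
Lemma commut_approx d f g k a : rises d f -> rises d g -> low k a ->
  low (k + d + (d + d)) (commut f g a - a -
    ((f (g a - a) - (g a - a)) - (g (f a - a) - (f a - a)))).
Proof.
move=> fd gd ka; rewrite -commut_defect.
have /(rises_comm fd gd) : low (k + d) (a - g (f a)).
  by rewrite -opprB; apply: lowN; rewrite -autME; apply: (risesM gd fd) ka.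
by rewrite linearB /=; congr low; coefwise.
Qed.

(** * Coefficients of the abelianization and equivariance *)

Lemma perm_pair s i j : perm_eq s [:: i; j] = (s \in [:: [:: i; j]; [:: j; i]]).
Proof.
have perm_ji : perm_eq [:: j; i] [:: i; j].
  by apply: (permEl (perm_catC [:: j] [:: i])).
rewrite !inE; apply/idP/orP => [sij|[] /eqP-> //].
have := perm_size sij; case: s sij => [|u [|v []]] // sij _.
have := perm_mem sij u; rewrite !inE eqxx /= => /esym/orP[] /eqP uE; subst u.
  by left; move: sij; rewrite perm_cons => /perm_small_eq->.
right; move: sij; rewrite perm_sym => /(perm_trans perm_ji).
by rewrite perm_cons perm_sym => /perm_small_eq->.
Qed.

Definition word_mnm s : 'X_{1..n} := (\sum_(i <- s) U_(i))%MM.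

Lemma word_mnm_eq s t : (word_mnm s == word_mnm t) = perm_eq s t.
Proof.
have E r i : word_mnm r i = count_mem i r.
  by rewrite /word_mnm mnm_sumE -sum1_count [RHS]big_mkcond;
     apply: eq_bigr => j _; rewrite mnm1E /=; case: eqP.
apply/eqP/idP => [st|/seq.permP st].
  by apply/allP => i _ /=; rewrite -!E st.
by apply/mnmP => i; rewrite !E st.
Qed.

Context (comm : {lrmorphism A -> {mpoly K[n]}}).
Context (comm_var : forall i, comm (x_ i) = 'X_i).

Lemma mpolyX_word s : 'X_[word_mnm s] = \prod_(i <- s) 'X_i :> {mpoly K[n]}.
Proof.
rewrite /word_mnm; elim: s => [|i s IH]; first by rewrite !big_nil mpolyX0.
by rewrite !big_cons mpolyXD IH.
Qed.

Lemma comm_word s : comm (word s) = 'X_[word_mnm s].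
Proof.
by rewrite mpolyX_word rmorph_prod; apply: eq_bigr => i _; apply: comm_var.
Qed.

(** The words with the same commutative image as [t] are its rearrangements. *)
Lemma comm_coef t a :
  (comm a)@_(word_mnm t) = \sum_(s <- permutations t) cf s a.
Proof.
elim/word_ind: a => [e a b Ha Hb||s].
- rewrite linearP mcoeffD mcoeffZ Ha Hb mulr_sumr -big_split /=.
  by apply: eq_bigr => s _; rewrite linearP.
- by rewrite linear0 mcoeff0 big1 // => s _; rewrite linear0.
rewrite comm_word mcoeffX word_mnm_eq -mem_permutations.
under eq_bigr do rewrite (cf_word wb).
rewrite -count_uniq_mem ?permutations_uniq // -sum1_count big_mkcond natr_sum.
by apply: eq_bigr => u _ /=; case: eqP.
Qed.

Lemma comm_coef0 a : (comm a)@_0 = cf [::] a.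
Proof.
have -> : 0%MM = word_mnm [::] by rewrite /word_mnm big_nil.
by rewrite comm_coef big_seq1.
Qed.

Lemma comm_coef1 a i : (comm a)@_U_(i) = cf [:: i] a.
Proof.
have -> : U_(i)%MM = word_mnm [:: i] by rewrite /word_mnm big_seq1.
by rewrite comm_coef big_seq1.
Qed.

Lemma comm_coef_sqr a i : (comm a)@_(U_(i) + U_(i)) = cf [:: i; i] a.
Proof.
have -> : (U_(i) + U_(i))%MM = word_mnm [:: i; i].
  by rewrite /word_mnm big_cons big_seq1.
rewrite comm_coef; transitivity (\sum_(s <- [:: [:: i; i]]) cf s a); last first.
  by rewrite big_seq1.
apply: perm_big; apply: uniq_perm; rewrite ?permutations_uniq // => s.
rewrite mem_permutations inE.
by rewrite perm_pair !inE orbb.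
Qed.

Lemma comm_coef_mixed a i j : i != j ->
  (comm a)@_(U_(i) + U_(j)) = cf [:: i; j] a + cf [:: j; i] a.
Proof.
move=> ij; have -> : (U_(i) + U_(j))%MM = word_mnm [:: i; j].
  by rewrite /word_mnm big_cons big_seq1.
rewrite comm_coef.
transitivity (\sum_(s <- [:: [:: i; j]; [:: j; i]]) cf s a); last first.
  by rewrite big_cons big_seq1.
apply: perm_big; apply: uniq_perm; rewrite ?permutations_uniq //.
  by rewrite /= inE eqseq_cons (negbTE ij).
move=> s; rewrite mem_permutations !inE.
by rewrite perm_pair !inE.
Qed.

(** A monomial of degree at most 1 has a single word above it, so its coefficient survives
    abelianization. *)
Lemma comm_low2 a : comm a = 0 -> low 2 a.
Proof.
move=> a0 [|i [|]] // _.
  by rewrite -comm_coef0 a0 mcoeff0.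
by rewrite -comm_coef1 a0 mcoeff0.
Qed.

Lemma linear_part a : low 1 a -> low 2 (a - \sum_u cf [:: u] a *: x_ u).
Proof.
move=> la s; rewrite ltnS leq_eqVlt => /orP[|s1]; last first.
  rewrite linearB /= la // sub0r raddf_sum /= big1 ?oppr0 // => i _.
  by rewrite linearZ /= (@low_var i) ?mulr0.
case: s => [|v []] // _; rewrite linearB /= raddf_sum /=.
rewrite (bigD1 v) //= linearZ /= cf_var eqxx mulr1.
rewrite big1 ?addr0 ?subrr // => u uv.
by rewrite linearZ /= cf_var eqseq_cons eq_sym (negbTE uv) mulr0.
Qed.

(** The Jacobian matrix at the origin, with row [u] for the image of [x_ u]. *)
Definition lin h u j := cf [:: j] (h (x_ u)).

Lemma quad_aut h a (j k : 'I_n) : rises 0 h -> low 2 a ->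
  cf [:: j; k] (h a) =
  \sum_u \sum_v cf [:: u; v] a * (lin h u j * lin h v k).
Proof.
move=> h0 la; have h1 u : low 1 (h (x_ u)) by apply: rises_low h0 (@low_var u).
have := rises_low h0 (low_quad la); rewrite linearB /= => H.
rewrite (low_cf H) // raddf_sum /= raddf_sum /=; apply: eq_bigr => u _.
rewrite !raddf_sum /=; apply: eq_bigr => v _; rewrite !linearZ /= rmorphM /=.
by rewrite (@cfM_low 1 1 [:: j] [:: k]).
Qed.

Lemma cubic_aut h (p q r j k l : 'I_n) : rises 0 h ->
  cf [:: j; k; l] (h (x_ p * x_ q * x_ r)) = lin h p j * lin h q k * lin h r l.
Proof.
move=> h0; have h1 u : low 1 (h (x_ u)) by apply: rises_low h0 (@low_var u).
rewrite !rmorphM /= (@cfM_low 2 1 [:: j; k] [:: l]) //; last exact: (@lowM 1 1).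
by rewrite (@cfM_low 1 1 [:: j] [:: k]).
Qed.

(** Commutation gives h (g x - x) = g (h x) - h x. In degree 2 the left side is the quadratic part
    of g x with the linear part of h substituted; on the right g - 1 raises degrees, so only the
    linear part of h x contributes. *)
Lemma quad_equivariance h g (r j k : 'I_n) : rises 0 h -> rises 1 g ->
  (h * g = g * h)%g ->
  \sum_u \sum_v cf [:: u; v] (g (x_ r)) * (lin h u j * lin h v k) =
  \sum_u lin h r u * cf [:: j; k] (g (x_ u)).
Proof.
move=> h0 g1 hg.
have cfx u v i : cf [:: u; v] (x_ i) = 0 by rewrite cf_var eqseq_cons andbF.
have gr : low 2 (g (x_ r) - x_ r) by apply: (g1 1); apply: low_var.
have := quad_aut j k h0 gr.
under eq_bigr do under eq_bigr do rewrite linearB /= cfx subr0.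
move=> <-; have -> : h (g (x_ r) - x_ r) = g (h (x_ r)) - h (x_ r).
  by rewrite linearB /= -[g (h _)]autME -hg.
pose b := \sum_u lin h r u *: (g (x_ u) - x_ u).
have H : low 3 (g (h (x_ r)) - h (x_ r) - b).
  have := g1 _ _ (linear_part (rises_low h0 (@low_var r))).
  rewrite [g (_ - _)]linearB /= [g (\sum_u _)]linear_sum /=; congr low.

  have -> : b = \sum_u g (lin h r u *: x_ u) - \sum_u lin h r u *: x_ u.
    by rewrite -sumrB; apply: eq_bigr => u _; rewrite linearZ scalerBr.
  by coefwise.
rewrite (low_cf H) // raddf_sum /=; apply: eq_bigr => u _.
by rewrite linearZ linearB /= cfx subr0.
Qed.

(** * Lifts of polynomial automorphisms *)

Definition lifts f (theta : Aut {mpoly K[n]}) :=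
  forall a, comm (f a) = theta (comm a).

Lemma lifts_var f theta i : lifts f theta -> comm (f (x_ i)) = theta 'X_i.
Proof. by move=> ->; rewrite comm_var. Qed.

Lemma liftsM f g theta eta :
  lifts f theta -> lifts g eta -> lifts (f * g)%g (theta * eta)%g.
Proof. by move=> ft ge a; rewrite !autME ft ge. Qed.

Lemma liftsV f theta : lifts f theta -> lifts f^-1%g theta^-1%g.
Proof.
move=> ft a; apply: (can_inj (aut_invK theta)).
by rewrite -ft autKV -[RHS]autME mulgV.
Qed.

Lemma lifts_rises0 f theta :
  lifts f theta -> (forall i, (theta 'X_i)@_0 = 0) -> rises 0 f.
Proof.
move=> ft t0; apply: rises_var => i; apply: lowB; last exact: low_var.
by case=> // _; rewrite -comm_coef0 (lifts_var _ ft) t0.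
Qed.

Lemma lifts_lin f theta u j : lifts f theta -> lin f u j = (theta 'X_u)@_U_(j).
Proof. by move=> ft; rewrite /lin -comm_coef1 (lifts_var _ ft). Qed.

Lemma quad_monomial h g (s : 'I_n -> 'I_n) (e : 'I_n -> K) (r j k : 'I_n) :
  rises 0 h -> rises 1 g -> (h * g = g * h)%g -> involutive s ->
  (forall u v, lin h u v = e u *+ (s u == v)) ->
  cf [:: s j; s k] (g (x_ r)) * (e (s j) * e (s k)) =
  e r * cf [:: j; k] (g (x_ (s r))).
Proof.
move=> h0 g1 hg sK hE; have := quad_equivariance r j k h0 g1 hg.
have sE u v : (s u == v) = (u == s v) by rewrite -(inj_eq (inv_inj sK)) sK.
rewrite (bigD1 (s j)) //= (bigD1 (s k)) //= !hE !sK !eqxx !mulr1n.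
rewrite big1 ?addr0 => [|v]; last first.
  by rewrite -sE hE => /negbTE->; rewrite !mulr0.
rewrite big1 ?addr0 => [|u]; last first.
  rewrite -sE => /negbTE uj; rewrite big1 // => v _.
  by rewrite hE uj mul0r mulr0.
move=> ->; rewrite (bigD1 (s r)) //= hE eqxx big1 ?addr0 // => u ur.
by rewrite hE eq_sym (negbTE ur) mul0r.
Qed.

(** Write c for the quadratic coefficients of g x_m. Equivariance at the word x_r x_q reads c(r,q) +
    c(r,p) = c(r,q); the word x_q x_r gives the other equation. *)
Lemma quad_transvection h g (p q r m : 'I_n) : p != q -> r != q -> m != p ->
  rises 0 h -> rises 1 g -> (h * g = g * h)%g ->
  (forall u v, lin h u v = (u == v)%:R + ((u == p) && (v == q))%:R) ->
  cf [:: r; p] (g (x_ m)) = 0 /\ cf [:: p; r] (g (x_ m)) = 0.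
Proof.
move=> pq rq mp h0 g1 hg hE.
have rhs (j k : 'I_n) : \sum_u lin h m u * cf [:: j; k] (g (x_ u)) =
    cf [:: j; k] (g (x_ m)).
  rewrite (bigD1 m) //= hE eqxx (negbTE mp) addr0 mul1r big1 ?addr0 // => u um.
  by rewrite hE eq_sym (negbTE um) (negbTE mp) addr0 mul0r.
have linr u : lin h u r = (u == r)%:R by rewrite hE (negbTE rq) andbF addr0.
have sumq (F : 'I_n -> K) : \sum_u F u * lin h u q = F q + F p.
  rewrite (bigD1 q) //= (bigD1 p) //= big1 => [|u /andP[uq up]]; last first.
    by rewrite hE (negbTE uq) (negbTE up) addr0 mulr0.
  by rewrite !hE !eqxx (negbTE pq) eq_sym (negbTE pq) /= !addr0 add0r !mulr1.
have sumr (F : 'I_n -> K) : \sum_u F u * lin h u r = F r.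
  rewrite (bigD1 r) //= linr eqxx mulr1 big1 ?addr0 // => u ur.
  by rewrite linr (negbTE ur) mulr0.
split.
  have := quad_equivariance m r q h0 g1 hg; rewrite rhs.
  rewrite (eq_bigr (fun u => (cf [:: u; q] (g (x_ m)) +
      cf [:: u; p] (g (x_ m))) * lin h u r)) => [|u _].
    by rewrite sumr => /eqP; rewrite addrC -subr_eq0 addrK => /eqP.
  rewrite mulrDl -(sumq (fun v => cf [:: u; v] (g (x_ m)) * lin h u r)).
  by apply: eq_bigr => v _; rewrite mulrA.
have := quad_equivariance m q r h0 g1 hg; rewrite rhs.
rewrite (eq_bigr (fun u => cf [:: u; r] (g (x_ m)) * lin h u q)) => [|u _].
  by rewrite sumq => /eqP; rewrite addrC -subr_eq0 addrK => /eqP.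
rewrite -(sumr (fun v => cf [:: u; v] (g (x_ m)) * lin h u q)).
by apply: eq_bigr => v _; rewrite mulrA.
Qed.

Lemma low3_of_low2 a :
  low 2 a -> (forall j k : 'I_n, cf [:: j; k] a = 0) -> low 3 a.
Proof.
move=> a2 a0 s; rewrite ltnS leq_eqVlt => /orP[|/a2 //].
by case: s => [|j [|k []]].
Qed.

Lemma cf2_var (j k i : 'I_n) : cf [:: j; k] (x_ i) = 0.
Proof. by rewrite cf_var eqseq_cons andbF. Qed.

(** With u = g y - y, the increment of y y is y u + u y + u u. Here u u lies in the fourth power of
    the ideal, and u agrees with e x x modulo the third. *)
Lemma low_square g (e : K) (y x : A) : low 1 x -> low 1 y ->
  low 3 (g y - y - e *: (x * x)) ->
  low 4 (g (y * y) - y * y - e *: (y * x * x + x * x * y)).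
Proof.
move=> x1 y1 gy; set u := g y - y in gy.
have u2 : low 2 u.
  rewrite -(subrK (e *: (x * x)) u); apply: lowD; first exact: low_le gy.
  by apply: lowZ; apply: (@lowM 1 1).
rewrite [X in low _ X](_ : _ = y * (u - e *: (x * x)) +
   (u - e *: (x * x)) * y + u * u).
  by do 2?apply: lowD;
     [apply: (@lowM 1 3)|apply: (@lowM 3 1)|apply: (@lowM 2 2)].
rewrite mulrBr mulrBl -(word_scalerAr wb) -scalerAl rmorphM /=.
have -> : g y = y + u by rewrite addrC subrK.
by rewrite mulrDl !mulrDr !mulrA; coefwise.
Qed.

(** Modulo the fourth power, z gains (g - 1)(f - 1) z - (f - 1)(g - 1) z. The first term is (g -
    1)(y y), given by [low_square]; the second vanishes because g z - z is already cubic and f - 1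
    raises it. *)
Lemma commut_square g f (e : K) (x y z : A) :
  rises 1 g -> rises 1 f -> low 1 x -> low 1 y -> low 1 z ->
  low 3 (f z - z - y * y) -> low 3 (g y - y - e *: (x * x)) ->
  low 3 (g z - z) ->
  low 4 (commut g f z - z - e *: (y * x * x + x * x * y)).
Proof.
move=> g1 f1 x1 y1 z1 fz gy gz.
have H1 := commut_approx g1 f1 z1.
have H2 := g1 _ _ fz; rewrite [g (_ - _)]linearB /= in H2.
have H3 := low_square x1 y1 gy; have H4 := f1 _ _ gz.
have := lowB (lowD (lowD H1 H2) H3) H4; congr low.
by coefwise.
Qed.

(** * Lifts in a subgroup on which abelianization is injective *)

Context (H : set (Aut A)).
Context (HM : forall f g, H f -> H g -> H (f * g)%g).
Context (HV : forall f, H f -> H f^-1%g).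
Context (H_inj : forall f g, H f -> H g ->
  (forall i, comm (f (x_ i)) = comm (g (x_ i))) -> f = g).

Definition elementary (p : 'I_n) (m : {mpoly K[n]})
    (theta : Aut {mpoly K[n]}) :=
  theta 'X_p = 'X_p + m /\ forall j, j != p -> theta 'X_j = 'X_j.

Definition monomial (s : 'I_n -> 'I_n) (e : 'I_n -> K)
    (theta : Aut {mpoly K[n]}) :=
  forall i, theta 'X_i = e i *: 'X_(s i).

Context (H_elementary : forall p (t : seq 'I_n), p \notin t -> t != [::] ->
  exists f theta, [/\ H f, lifts f theta
    & elementary p (\prod_(q <- t) 'X_q) theta]).
Context (H_monomial : forall (s : 'I_n -> 'I_n) (e : 'I_n -> K),
  involutive s -> (forall i, e i * e (s i) = 1) ->
  exists f theta, [/\ H f, lifts f theta & monomial s e theta]).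

(** The transfer principle: a relation between polynomial automorphisms, checked on the variables,
    holds for their lifts in [H]. *)
Lemma lifts_eq f g theta eta : H f -> H g -> lifts f theta -> lifts g eta ->
  (forall i, theta 'X_i = eta 'X_i) -> f = g.
Proof.
move=> Hf Hg ft ge te; apply: H_inj => // i.
by rewrite (lifts_var _ ft) (lifts_var _ ge).
Qed.

Lemma elementary_rises1 f theta p (a : A) : lifts f theta ->
  low 2 a -> elementary p (comm a) theta -> rises 1 f.
Proof.
move=> ft a2 [tp tj]; apply: rises_var => i; have [->|ip] := eqVneq i p.
  rewrite -(subrK a (f _ - _)); apply: lowD => //; apply: comm_low2.
  by rewrite !linearB /= (lifts_var _ ft) comm_var tp addrAC addrK subrr.
by apply: comm_low2; rewrite linearB /= (lifts_var _ ft) comm_var tj // subrr.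
Qed.

Lemma monomial_rises0 h theta (s : 'I_n -> 'I_n) e :
  lifts h theta -> monomial s e theta ->
  rises 0 h.
Proof.
move=> ht te; apply: lifts_rises0 ht _ => i.
by rewrite te mcoeffZ mcoeffX mnm1_eq0 mulr0.
Qed.

Lemma monomial_lin h theta (s : 'I_n -> 'I_n) e u v :
  lifts h theta -> monomial s e theta ->
  lin h u v = e u *+ (s u == v).
Proof.
by move=> ht te; rewrite (lifts_lin _ _ ht) te mcoeffZ mcoeffXU mulr_natr.
Qed.

Lemma transvection_lin h theta p q u v : lifts h theta ->
  elementary p 'X_q theta ->
  lin h u v = (u == v)%:R + ((u == p) && (v == q))%:R.
Proof.
move=> ht [tp tj]; rewrite (lifts_lin _ _ ht).
have [->|up] := eqVneq u p; last by rewrite tj // mcoeffXU addr0.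
by rewrite tp mcoeffD !mcoeffXU [q == v]eq_sym.
Qed.

Lemma transvection_rises0 h theta p q : lifts h theta ->
  elementary p 'X_q theta -> rises 0 h.
Proof.
move=> ht [tp tj]; apply: lifts_rises0 ht _ => i.
have [->|ip] := eqVneq i p.
  by rewrite tp mcoeffD !mcoeffX !mnm1_eq0 addr0.
by rewrite tj // mcoeffX mnm1_eq0.
Qed.

(** In g x_p the coefficients of squares are visible after abelianization. The other coefficients
    are killed by automorphisms commuting with [theta]: the sign changes of x_s for s != p, and, for
    the words x_r x_p and x_p x_r in g x_r, the transvection x_p -> x_p + x_q. *)
Lemma square_lift g theta p q : 2%:R != 0 :> K -> p != q -> H g ->
  lifts g theta -> elementary p ('X_q * 'X_q) theta ->
  [/\ rises 1 g, low 3 (g (x_ p) - x_ p - x_ q * x_ q)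
    & forall r, r != p -> r != q -> low 3 (g (x_ r) - x_ r)].
Proof.
move=> K2 pq Hg gt tE; have [tp tj] := tE.
have qq2 : low 2 (x_ q * x_ q) by apply: (@lowM 1 1); apply: low_var.
have commqq : comm (x_ q * x_ q) = 'X_q * 'X_q by rewrite rmorphM /= comm_var.
have g1 : rises 1 g.
  by apply: (@elementary_rises1 g theta p _ gt qq2); rewrite commqq.
have eq_opp (c : K) : - c = c -> c = 0.
  move=> /eqP; rewrite -subr_eq0 -opprD oppr_eq0 -mulr2n -mulr_natl mulf_eq0.
  by rewrite (negbTE K2) => /eqP.
have sign (s r j k : 'I_n) : s != p ->
    cf [:: j; k] (g (x_ r)) * ((-1) ^+ (j == s) * (-1) ^+ (k == s)) =
    (-1) ^+ (r == s) * cf [:: j; k] (g (x_ r)).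
  move=> sp; pose e i : K := (-1) ^+ (i == s).
  have [|h [eta [Hh ht he]]] := @H_monomial id e (fun i => erefl).
    by move=> i; rewrite -signr_addb addbb.
  apply: (@quad_monomial h g id e) => //.
  - exact: monomial_rises0 ht he.
  - apply: lifts_eq (liftsM ht gt) (liftsM gt ht) _; try exact: HM.
    move=> i; rewrite !autME (he i) linearZ /=; have [->|ip] := eqVneq i p.
      rewrite tp rmorphD rmorphM /= !he /e eq_sym (negbTE sp) expr0 !scale1r.
      by rewrite -scalerAl -scalerAr scalerA -signr_addb addbb scale1r.
    by rewrite tj.
  - by move=> u v; apply: monomial_lin ht he.
have pNq : p \notin [:: q] by rewrite inE.
have [h [eta [Hh ht he]]] := H_elementary pNq isT.
rewrite big_seq1 in he; have [hp hj] := he.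
have transv r m := @quad_transvection h g p q r m pq.
have hg : (h * g = g * h)%g.
  apply: lifts_eq (liftsM ht gt) (liftsM gt ht) _; try exact: HM.
  have qp : q != p by rewrite eq_sym.
  move=> i; rewrite !autME; have [->|ip] := eqVneq i p.
    by rewrite tp hp !rmorphD rmorphM /= tp hp hj // tj // addrAC.
  by rewrite tj // hj // tj.
have h0 := transvection_rises0 ht he.
have hlin u v := transvection_lin u v ht he.
split=> // [|r rp rq].
  have gpp : comm (g (x_ p) - x_ p - x_ q * x_ q) = 0.
    by rewrite !linearB /= (lifts_var _ gt) commqq comm_var tp addrAC
      addrK subrr.
  apply: low3_of_low2 => [|j k]; first exact: comm_low2.
  have [<-|jk] := eqVneq j k; first by rewrite -comm_coef_sqr gpp mcoeff0.
  rewrite !linearB /= cf2_var subr0.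
  rewrite (@cfM_low 1 1 [:: j] [:: k]) //; try exact: low_var.
  have -> : cf [:: j] (x_ q) * cf [:: k] (x_ q) = 0.
    rewrite !cf_var !eqseq_cons !andbT; case: eqP => [<-|];
      last by rewrite mul0r.
    by rewrite eq_sym (negbTE jk) mulr0.
  (* Of two distinct letters one differs from [p]; changing its sign negates the coefficient. *)
  rewrite subr0; have [jp|jp] := eqVneq j p.
    have kp : k != p by rewrite -jp eq_sym.
    have := sign k p j k kp; rewrite eqxx (negbTE jk) eq_sym (negbTE kp).
    by rewrite expr0 expr1 !mul1r mulrN1 => /eq_opp.
  have := sign j p j k jp; rewrite eqxx [k == j]eq_sym (negbTE jk) eq_sym.
  by rewrite (negbTE jp) expr0 expr1 mulr1 mul1r mulrN1 => /eq_opp.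
apply: low3_of_low2 => [|j k]; first by apply: (g1 1); apply: low_var.
rewrite linearB /= cf2_var subr0.
have [->|jr] := eqVneq j r; have [->|kr] := eqVneq k r.
- have := sign r r r r rp; rewrite eqxx expr1 mulrNN mulr1 mulr1 mulN1r.
  by move/esym/eq_opp.
- have [->|kp] := eqVneq k p; first by case: (transv r r rq rp h0 g1 hg hlin).
  have := sign k r r k kp; rewrite eqxx [r == k]eq_sym (negbTE kr).
  by rewrite expr0 expr1 !mul1r mulrN1 => /eq_opp.
- have [->|jp] := eqVneq j p; first by case: (transv r r rq rp h0 g1 hg hlin).
  have := sign j r j r jp; rewrite eqxx [r == j]eq_sym (negbTE jr).
  by rewrite expr0 expr1 !mulr1 mul1r mulrN1 => /eq_opp.
have := sign r r j k rp; rewrite eqxx (negbTE jr) (negbTE kr).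
by rewrite expr0 expr1 !mulr1 mulN1r => /esym/eq_opp.
Qed.

Implicit Types (theta eta zeta : Aut {mpoly K[n]}).

Lemma elementaryV p (m : {mpoly K[n]}) theta :
  elementary p m theta -> theta m = m -> elementary p (- m) theta^-1%g.
Proof.
move=> [tp tj] tm; split=> [|j jp]; apply: (can_inj (aut_invK theta)).
  by rewrite [LHS]autKV linearB /= tp tm addrK.
by rewrite [LHS]autKV tj.
Qed.

Lemma elementaryM p (m m' : {mpoly K[n]}) theta eta :
  elementary p m theta -> elementary p m' eta -> theta m' = m' ->
  elementary p (m + m') (theta * eta)%g.
Proof.
move=> [tp tj] [ep ej] tm'; split=> [|j jp]; last by rewrite autME ej ?tj.
by rewrite autME ep linearD /= tp tm' addrA.
Qed.

(** The last hypothesis makes the conjugate fix every variable other than x_p. *)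
Lemma elementary_conj p (m : {mpoly K[n]}) theta eta :
  elementary p m theta -> eta 'X_p = 'X_p ->
  (forall j, j != p -> theta (eta^-1%g 'X_j) = eta^-1%g 'X_j) ->
  elementary p (eta m) (eta * theta * eta^-1)%g.
Proof.
move=> [tp tj] ep ej; split=> [|j jp]; rewrite !autME;
  last by rewrite ej ?autKV.
have -> : eta^-1%g 'X_p = 'X_p by rewrite -{1}ep autVK.
by rewrite tp linearD /= ep.
Qed.

Lemma elementary_fix p (m : {mpoly K[n]}) theta (e : K) (i j k : 'I_n) :
  elementary p m theta -> i != p -> j != p -> k != p ->
  theta (e *: ('X_i * 'X_j * 'X_k)) = e *: ('X_i * 'X_j * 'X_k).
Proof. by move=> [_ tj] ip jp kp; rewrite autZ !autM !tj. Qed.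

(** * Two contradictory conclusions about 2 in the field *)

Section ThreeVariables.
Context (x y z : 'I_n) (xy : x != y) (xz : x != z) (yz : y != z).

Lemma two_neq0 : 2%:R != 0 :> K.
Proof.
have zNxy : z \notin [:: x; y] by rewrite !inE ![z == _]eq_sym negb_or xz.
have [g [theta [Hg gt gE]]] := H_elementary zNxy isT.
rewrite big_cons big_seq1 in gE; have [tz tj] := gE.
pose s := tperm x y; have sK : involutive s by exact: tpermK.
have sz : s z = z by rewrite tpermD.
have [|h [eta [Hh ht he]]] := @H_monomial s (fun=> 1) sK;
  first by rewrite mulr1.
have g1 : rises 1 g.
  apply: (@elementary_rises1 g theta z (x_ x * x_ y)) => //.
    by apply: (@lowM 1 1); apply: low_var.
  by rewrite rmorphM /= !comm_var.
have hg : (h * g = g * h)%g.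
  apply: lifts_eq (liftsM ht gt) (liftsM gt ht) _; try exact: HM.
  move=> i; rewrite !autME (he i) linearZ /=; have [->|iz] := eqVneq i z.
    rewrite sz tz rmorphD rmorphM /= !he sz !scale1r tpermL tpermR.
    by rewrite ['X_y * _]mulrC.
  by rewrite tj // he tj // -sz (inj_eq (inv_inj sK)).
(* At the word y x, equivariance under the swap equates its coefficient with that of x y. *)
have := @quad_monomial h g s (fun=> 1) z y x (monomial_rises0 ht he) g1 hg sK
   (fun u v => monomial_lin u v ht he).
rewrite !mulr1 mul1r sz tpermL tpermR => cxy.
have := comm_coef_mixed (g (x_ z)) xy.
rewrite (lifts_var _ gt) tz mcoeffD -mpolyXD !mcoeffX eqxx -cxy.
have -> : (U_(z) == U_(x) + U_(y))%MM = false.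
  by apply/eqP => /(congr1 (@mdeg n)); rewrite mdegD !mdeg1.
rewrite add0r => /esym c1; apply/eqP => K2.
by have := oner_neq0 K; rewrite -[1]c1 -mulr2n -mulr_natl K2 mul0r eqxx.
Qed.

Lemma sum_of_defects a f g : rises 2 f -> rises 2 g -> low 1 a ->
  low 4 ((f * g)%g a - a - ((f a - a) + (g a - a))).
Proof.
by move=> f2 g2 a1; apply: low_le (risesM_approx f2 g2 a1).
Qed.

(** For theta : y -> y + x^2 and eta : z -> z + y^2, the commutators of theta and of theta^-1 with
    eta send z to z + 2 x^2 y + x^4 and z - 2 x^2 y + x^4. Their quotient removes x^4 and leaves 4
    x^2 y. *)
Lemma cubic_lift : 2%:R != 0 :> K -> exists f theta, [/\ H f, lifts f theta,
  elementary z (4%:R *: ('X_x * 'X_x * 'X_y)) theta, rises 2 f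
  & low 4 (f (x_ z) - x_ z -
      2%:R *: (x_ y * x_ x * x_ x + x_ x * x_ x * x_ y))].
Proof.
move=> K2.
have yNx : y \notin [:: x; x] by rewrite !inE orbb eq_sym.
have zNy : z \notin [:: y; y] by rewrite !inE orbb eq_sym.
have [g [theta [Hg gt gE]]] := H_elementary yNx isT.
have [k [eta [Hk ke kE]]] := H_elementary zNy isT.
rewrite big_cons big_seq1 in gE; rewrite big_cons big_seq1 in kE.
have yx : y != x by rewrite eq_sym.
have zy : z != y by rewrite eq_sym.
have zx : z != x by rewrite eq_sym.
have [g1 gy gr] := square_lift K2 yx Hg gt gE.
have [k1 kz _] := square_lift K2 zy Hk ke kE.
have gz := gr z zy zx.
have xl := low_var x; have yl := low_var y; have zl := low_var z.
have w1 : low 4 (commut g k (x_ z) - x_ z -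
    1 *: (x_ y * x_ x * x_ x + x_ x * x_ x * x_ y)).
  by apply: commut_square => //; rewrite scale1r.
have gV1 := risesV g1.
(* Inverting [g] changes the sign of its quadratic part, hence the factor -1. *)
have w2 : low 4 (commut g^-1%g k (x_ z) - x_ z -
    (-1) *: (x_ y * x_ x * x_ x + x_ x * x_ x * x_ y)).
  apply: commut_square => //.
    have := lowB (risesV_approx g1 yl) gy; congr low.
    by coefwise.
  have := lowB (risesV_approx g1 zl) gz; congr low.
  by coefwise.
have r1 := rises_comm g1 k1; have r2 := rises_comm gV1 k1.
exists (commut g k * (commut g^-1 k)^-1)%g.
exists (commut theta eta * (commut theta^-1 eta)^-1)%g.
split.
- by rewrite /commut; do !(apply: HM || apply: HV).
- by rewrite /commut; do !(apply: liftsM || apply: liftsV).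
- have gx : theta ('X_x * 'X_x) = 'X_x * 'X_x by rewrite rmorphM /= gE.2.
  have ky : eta ('X_y * 'X_y) = 'X_y * 'X_y by rewrite rmorphM /= kE.2.
  have [ty tj] := gE; have [ez ej] := kE.
  have [tVy tVj] := elementaryV gE gx; have [eVz eVj] := elementaryV kE ky.
  (* The inner eta^-1 and eta cancel, leaving theta eta theta^-1 theta^-1 eta^-1 theta. *)
  rewrite /commut; split=> [|j jz]; rewrite !invgM !invgK !mulgA mulgVK !autME.
    rewrite tj // eVz !(autD, autN, autM) (tVj z) // tVy.
    rewrite !(autD, autN, autM) (tVj z) // (tVj x) // tVy.
    rewrite !(autD, autN, autM) ez (ej x) // (ej y) //.
    rewrite !(autD, autN, autM) (tj x) // (tj z) // ty.
    by rewrite scaler_nat; ring.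
  have [->|jy] := eqVneq j y; last by rewrite tj ?eVj ?tVj ?ej ?tj.
  rewrite ty !(autD, autM) (eVj y) // (eVj x) // (tVj x) // tVy.
  rewrite !(autD, autN, autM) subrK tVy !(autD, autN, autM) (ej y) // (ej x) //.
  by rewrite ty (tj x) // addrK.
- by apply: risesM => //; apply: risesV.
have a1 := sum_of_defects r1 (risesV r2) zl.
have a2 := low_le (isT : (4 <= 1 + 2 + 2)%N) (risesV_approx r2 zl).
have := lowD (lowB (lowD a1 a2) w2) w1; congr low.
by coefwise.
Qed.

(** The difference h^-1 z - z has degree at least 2, where f - 1 only produces degree 4. So, modulo
    degree 4, the conjugate adds to z the image under h of the cubic part of f z. *)
Lemma cubic_conj h eta f : rises 2 f -> rises 0 h ->
  low 4 (f (x_ z) - x_ z -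
    2%:R *: (x_ y * x_ x * x_ x + x_ x * x_ x * x_ y)) ->
  lifts h eta -> eta 'X_z = 'X_z ->
  cf [:: x; y; y] ((h * f * h^-1)%g (x_ z)) =
  2%:R * (lin h y x * lin h x y * lin h x y +
          lin h x x * lin h x y * lin h y y).
Proof.
move=> f2 h0 fz ht ez; rewrite !autME.
set a := h^-1%g (x_ z).
have a2 : low 2 (a - x_ z).
  apply: comm_low2; rewrite linearB /= comm_var (lifts_var _ (liftsV ht)).
  by rewrite -{1}ez -autME mulVg subrr.
have ha : h a = x_ z by rewrite autKV.
have H1 := rises_low h0 (f2 _ _ a2); have H2 := rises_low h0 fz.
pose b := x_ z + 2%:R *: (h (x_ y * x_ x * x_ x) + h (x_ x * x_ x * x_ y)).
have H3 : low 4 (h (f a) - b).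
  have := lowD H1 H2; rewrite /b !(autD, autN, autZ) ha; congr low.
  by coefwise.
rewrite (low_cf H3) // linearD linearZ linearD /= !cubic_aut //.
by rewrite cf_var eqseq_cons andbF add0r.
Qed.

Lemma cubic_additive f g : rises 2 f -> rises 2 g ->
  cf [:: x; y; y] ((f * g)%g (x_ z)) =
  cf [:: x; y; y] (f (x_ z)) + cf [:: x; y; y] (g (x_ z)).
Proof.
move=> f2 g2; have cz : cf [:: x; y; y] (x_ z) = 0.
  by rewrite cf_var eqseq_cons andbF.
have := low_cf (sum_of_defects f2 g2 (low_var z))
  (isT : size [:: x; y; y] < 4)%N.
by rewrite linearB linearD /= !linearB /= cz !subr0.
Qed.

Lemma two_eq0 : 2%:R = 0 :> K.
Proof.
apply/eqP/negPn/negP => K2.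
have [f [theta [Hf ft fE f2 fz]]] := cubic_lift K2.
have xNy : x \notin [:: y] by rewrite inE.
have [t [eta [Ht te tE]]] := H_elementary xNy isT; rewrite big_seq1 in tE.
pose s := tperm x y; have sK : involutive s by exact: tpermK.
have [|h [zeta [Hh hz hE]]] := @H_monomial s (fun=> 1) sK;
  first by rewrite mulr1.
have zx : z != x by rewrite eq_sym.
have zy : z != y by rewrite eq_sym.
have yx : y != x by rewrite eq_sym.
have sz : s z = z by rewrite tpermD.
have ey : eta 'X_y = 'X_y by apply: tE.2.
have tVE := elementaryV tE ey.
have [ex ej] := tE; have [eVx eVj] := tVE; have [tz tj] := fE.
have t0 := transvection_rises0 te tE.
have tV0 := rises0V t0.
have h0 := monomial_rises0 hz hE.
have zetaV j : zeta^-1%g 'X_j = 'X_(s j).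
  by apply: (can_inj (aut_invK zeta)); rewrite [LHS]autKV hE sK scale1r.
have zetaz : zeta 'X_z = 'X_z by rewrite hE sz scale1r.
pose m : {mpoly K[n]} := 4%:R *: ('X_x * 'X_x * 'X_y); rewrite -/m in fE tz.
have c1 : elementary z (eta m) (eta * theta * eta^-1)%g.
  apply: (elementary_conj fE (ej z zx)) => j jz.
  have [->|jx] := eqVneq j x; last by rewrite eVj // tj.
  by rewrite eVx autD autN !tj.
have c2 : elementary z (eta^-1%g m) (eta^-1 * theta * eta^-1^-1)%g.
  apply: (elementary_conj fE (eVj z zx)) => j jz; rewrite invgK.
  have [->|jx] := eqVneq j x; last by rewrite ej // tj.
  by rewrite ex autD !tj.
have c3 : elementary z (zeta m) (zeta * theta * zeta^-1)%g.
  apply: (elementary_conj fE zetaz) => j jz; rewrite zetaV tj // -sz.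
  by rewrite (inj_eq (inv_inj sK)).
have zm : zeta m = 4%:R *: ('X_y * 'X_y * 'X_x).
  by rewrite autZ !autM !hE !scale1r tpermL tpermR.
rewrite zm in c3.
(* Two doublings give the fourth power of the swapped map, which adds 16 y^2 x to z. *)
have c33 := elementaryM c3 c3 (elementary_fix _ c3 yz yz xz).
have c3333 := elementaryM c33 c33; rewrite -scalerDl in c33 c3333.
have {c3333}c3333 := c3333 (elementary_fix _ c33 yz yz xz).
rewrite -scalerDl in c3333.
have [rz rj] := elementaryM c2 c3333 (elementary_fix _ c2 yz yz xz).
pose u := (h * f * h^-1)%g.
have Hu : H u by do !(apply: HM || apply: HV).
have rel : (t * f * t^-1 = t^-1 * f * t^-1^-1 * (u * u * (u * u)))%g.
  apply: lifts_eq (liftsM (liftsM te ft) (liftsV te)) _ _.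
  - by do !(apply: HM || apply: HV).
  - by do !(apply: HM || apply: HV).
  - apply: liftsM;
      first exact: (liftsM (liftsM (liftsV te) ft) (liftsV (liftsV te))).
    have hu := liftsM (liftsM hz ft) (liftsV hz).
    exact: (liftsM (liftsM hu hu) (liftsM hu hu)).
  move=> i; have [->|iz] := eqVneq i z; last by rewrite rj // c1.2.
  rewrite rz c1.1; congr (_ + _).
  (* The identity is 4 (x + y)^2 y = 4 (x - y)^2 y + 16 y^2 x. *)
  rewrite !(autZ, autM) ex eVx ey (eVj _ yx) -!natrD !scaler_nat.
  by ring.
have u2 : rises 2 u by apply: rises_conj.
have /(congr1 (fun w : Aut A => cf [:: x; y; y] (w (x_ z)))) := rel.
have fV := rises_conj tV0 f2; have uu := risesM u2 u2.
rewrite (cubic_additive fV (risesM uu uu)) (cubic_additive uu uu)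
  (cubic_additive u2 u2).
rewrite (cubic_conj f2 t0 fz te (ej z zx)).
rewrite (cubic_conj f2 tV0 fz (liftsV te) (eVj z zx)).
rewrite (cubic_conj f2 h0 fz hz zetaz).
(* The conjugates by [t], its inverse and the swap have coefficients 2, -2 and 2, the last counted
   four times: 2 = -2 + 8. *)
rewrite !(transvection_lin _ _ te tE) !(monomial_lin _ _ hz hE) tpermL tpermR.
rewrite !(lifts_lin _ _ (liftsV te)) eVx (eVj _ yx) mcoeffB !mcoeffXU.
rewrite mcoeffD mcoeffN !mcoeffXU !eqxx (negbTE xy) (negbTE yx) /= => H0.
suff K4 : 2%:R * 2%:R = 0 :> K.
  by move/eqP: K4; rewrite mulf_eq0 orbb (negbTE K2).
move: H0 => /eqP; rewrite -subr_eq0 => /eqP H0; rewrite -oppr0 -H0; ring.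
Qed.

End ThreeVariables.

End Words.

(** * The free algebra and the polynomial automorphisms *)

Section FreeAlgebra.
Context (K : fieldType) (n : nat).
Local Notation F := (free_alg K n).

Definition word_coef (s : seq 'I_n) (a : F) : K := monalg.mcoeff (FMonom s) a.

Fact word_coef_is_linear s : scalar (word_coef s).
Proof. by move=> c a b; rewrite /word_coef monalg.mcoeffD monalg.mcoeffZ. Qed.
HB.instance Definition _ s :=
  GRing.isLinear.Build K F K *%R (word_coef s) (@word_coef_is_linear s).

(* [malg] carries only a left-algebra structure when the monomials do not
   commute, so [scalerAr] does not apply to it. *)
Lemma free_scalerAr (e : K) (a b : F) : e *: (a * b) = a * (e *: b).
Proof.
have central : GRing.comm a (mkmalgU mone e : F).
  rewrite (monalgE a); apply: commr_sym; apply: commr_sum => w _.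
  by rewrite /GRing.comm !malgM_def !fgmulUU mul1m mulm1 mulrC.
rewrite -!mul_malgC mulrA -central.
exact/esym/mulrA.
Qed.

Lemma free_word_basis :
  word_basis (@free_var K n) (fun s => (word_coef s : {scalar F})).
Proof.
split=> [a|s t|]; last exact: free_scalerAr.
- exists [seq fmonom_val w | w <- enum_fset (monalg.msupp a)].
  rewrite big_map {1}(monalgE a); apply: eq_bigr => w _.
  have -> : word (@free_var K n) w = mkmalgU w 1 by rewrite free_word.
  rewrite /= /word_coef fmK; apply/malgP => v.
  by rewrite monalg.mcoeffZ [LHS]mcoeffU (mcoeffU w 1 v) mulrnAr mulr1.
have -> : word (@free_var K n) t = mkmalgU (FMonom t) 1 by rewrite free_word.
by rewrite /= /word_coef mcoeffU1 fmP /= eq_sym.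
Qed.

End FreeAlgebra.

(** * Monomial and elementary polynomial automorphisms *)

Section PolynomialAutomorphisms.
Context (K : fieldType) (n : nat).
Local Notation P := {mpoly K[n]}.
Implicit Types (theta : Aut P) (p q : P) (i j : 'I_n).

Lemma mpoly_ext (f g : {lrmorphism P -> P}) :
  (forall i, f 'X_i = g 'X_i) -> f =1 g.
Proof.
move=> fg p; rewrite (mpolyE p) !linear_sum; apply: eq_bigr => m _ /=.
rewrite !linearZ /= mpolyXE_id !rmorph_prod; congr (_ *: _).
by apply: eq_bigr => i _; rewrite !rmorphXn /= fg.
Qed.

Definition subst (f : 'I_n -> P) : P -> P := comp_mpoly [tuple f i | i < n].
HB.instance Definition _ f := GRing.LRMorphism.on (subst f).

Lemma substX f i : subst f 'X_i = f i.
Proof. by rewrite /subst comp_mpolyXU -tnth_nth tnth_mktuple. Qed.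

Lemma subst_aut (f g : 'I_n -> P) :
  (forall i, subst f (g i) = 'X_i) -> (forall i, subst g (f i) = 'X_i) ->
  exists theta, forall i, theta 'X_i = f i.
Proof.
have K1 f1 f2 : (forall i, subst f1 (f2 i) = 'X_i) ->
    cancel (subst f2) (subst f1).
  move=> f12 p; apply: (@mpoly_ext (subst f1 \o subst f2) idfun) => i /=.
  by rewrite substX f12.
move=> fg gf; have ax : `[< is_alg_aut (subst f) >].
  apply/asboolP; split; first exact: linearP.
    by split; [exact: rmorph1 | exact: rmorphM].
  exact: Bijective (K1 _ _ gf) (K1 _ _ fg).
by exists (MkAut ax) => i /=; rewrite substX.
Qed.

(** The condition on [e] makes the substitution its own inverse. *)
Lemma monomial_aut (s : 'I_n -> 'I_n) (e : 'I_n -> K) :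
  involutive s -> (forall i, e i * e (s i) = 1) ->
  exists theta, monomial s e theta.
Proof.
move=> sK se.
have f2 i : subst (fun i => e i *: 'X_(s i)) (e i *: 'X_(s i)) = 'X_i.
  by rewrite linearZ /= substX sK scalerA se scale1r.
exact: (subst_aut f2 f2).
Qed.

Lemma elementary_aut_ex i (t : seq 'I_n) : i \notin t ->
  exists theta, elementary i (\prod_(j <- t) 'X_j) theta.
Proof.
(* The values 1 and -1 of [e] give inverse substitutions, as the added product does not involve
   x_i. *)
move=> it; pose f (e : K) j : P :=
  'X_j + (e *+ (j == i)) *: \prod_(k <- t) 'X_k.
have ft e e' : subst (f e) (e' *: \prod_(k <- t) 'X_k) =
    e' *: \prod_(k <- t) 'X_k.
  rewrite linearZ rmorph_prod /=; congr (_ *: _).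
  rewrite !big_seq; apply: eq_bigr => k kt; rewrite substX /f.
  by case: eqP kt it => [->->|]; rewrite // scale0r addr0.
have fK e j : subst (f e) (f (- e) j) = 'X_j.
  by rewrite {2}/f linearD /= ft substX /f mulNrn scaleNr addrK.
have fVK j : subst (f (-1)) (f 1 j) = 'X_j by have := fK (-1) j; rewrite opprK.
have [theta thetaE] := subst_aut (fK 1) fVK.
exists theta; split=> [|j /negbTE ji]; rewrite thetaE /f.
  by rewrite eqxx scale1r.
by rewrite ji scale0r addr0.
Qed.

Lemma tuple1E (t : 1.-tuple 'I_n) : t = [:: thead t] :> seq 'I_n.
Proof.
by rewrite {1}(tuple_eta t) /= (size0nil (size_tuple (behead_tuple t))).
Qed.

Lemma aug1_var i : aug_pow 1 ('X_i : P).
Proof.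
exists (fun t => (thead t == i)%:R).
rewrite (bigD1 [tuple i]) //= big_seq1 (eqxx i) mul1r big1 ?addr0 // => t ti.
rewrite [thead t == i]negbTE ?mul0r //; apply: contra ti => /eqP ti.
by apply/eqP/val_inj; rewrite /= tuple1E ti.
Qed.

Lemma aug_powD m p q : aug_pow m p -> aug_pow m q -> aug_pow m (p + q).
Proof.
move=> [c ->] [d ->]; exists (fun t => c t + d t).
by rewrite -big_split; apply: eq_bigr => t _; rewrite mulrDl.
Qed.

Lemma aug_pow0 m : @aug_pow K n m 0.
Proof. by exists (fun=> 0); rewrite big1 // => t _; rewrite mul0r. Qed.

Lemma aug_powMl m p q : aug_pow m q -> aug_pow m (p * q).
Proof.
move=> [c ->]; exists (fun t => p * c t).
by rewrite mulr_sumr; apply: eq_bigr => t _; rewrite mulrA.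
Qed.

Lemma Aut0_gen theta : (forall i, aug_pow 1 (theta 'X_i)) -> Aut0 theta.
Proof.
move=> ti p [c ->]; rewrite linear_sum.
apply: (big_ind (aug_pow 1)) => [||t _]; [exact: aug_pow0|exact: aug_powD|].
rewrite rmorphM /=; apply: aug_powMl.
by rewrite tuple1E big_seq1; apply: ti.
Qed.

Lemma TAut_NAut theta : TAut theta -> NAut theta.
Proof.
move=> tT m; exists 1%g, theta; split; rewrite ?mul1g // => i.
by rewrite aut1E subrr; apply: aug_pow0.
Qed.

Lemma linear_TAut theta : linear_aut theta -> TAut theta.
Proof. by move=> tl; apply: sub_gen_smallest; left. Qed.

Lemma elementary_TAut theta : elementary_aut theta -> TAut theta.
Proof. by move=> tl; apply: sub_gen_smallest; right. Qed.

Lemma monomial_linear s e theta : monomial s e theta -> linear_aut theta.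
Proof.
move=> tE; exists (\matrix_(i, j) (e i *+ (s i == j))) => i.
rewrite tE (bigD1 (s i)) //= mxE eqxx big1 ?addr0 // => j ji.
by rewrite mxE eq_sym (negbTE ji) scale0r.
Qed.

Lemma elementary_elementary i (t : seq 'I_n) theta : i \notin t ->
  elementary i (\prod_(j <- t) 'X_j) theta -> elementary_aut theta.
Proof.
move=> it [ti tj]; exists i, (\prod_(j <- t) 'X_j); split=> // m.
rewrite -mpolyX_word msuppX inE => /eqP->; rewrite mnm_sumE big_seq.
by apply: big1 => j jt; rewrite mnm1E; case: eqP jt it => // -> ->.
Qed.

End PolynomialAutomorphisms.

(** Treats both groups at once: the argument lifts only linear and elementary automorphisms
    preserving the origin, which lie in each of them. *)
Lemma no_section (K : fieldType) (n : nat) (G : set (Aut {mpoly K[n]})) :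
  (2 < n)%N ->
  (forall theta, linear_aut theta \/ elementary_aut theta ->
    (forall i, aug_pow 1 (theta 'X_i)) -> G theta) ->
  ~ exists H : set (Aut (free_alg K n)),
      is_subgroup H /\ set_bij H G (@abel K n).
Proof.
move=> n_gt2 G_gen [H [H_group [_ abel_inj abel_surj]]].
have HM f g : H f -> H g -> H (f * g)%g.
  by move=> /mem_set Hf /mem_set Hg; apply/set_mem;
     exact: (group_closedM H_group).
have HV f : H f -> H f^-1%g.
  by move=> /mem_set Hf; apply/set_mem; exact: (group_closedV H_group).
have abelX (f : Aut (free_alg K n)) i :
    abel f 'X_i = comm_proj (f (free_var K i)).
  by rewrite -abel_proj comm_proj_var.
have H_inj f g : H f -> H g ->
    (forall i, comm_proj (f (free_var K i)) = comm_proj (g (free_var K i))) ->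
    f = g.
  move=> Hf Hg fg; apply: abel_inj; [exact: mem_set|exact: mem_set|apply: autP].
  by apply: (@mpoly_ext K n (abel f) (abel g)) => i;
     have := fg i; rewrite -!abelX.
pose pi : {lrmorphism free_alg K n -> {mpoly K[n]}} := @comm_proj K n.
have lift theta : G theta -> exists f, H f /\ lifts pi f theta.
  move=> /abel_surj [f Hf <-]; exists f; split=> // a.
  by rewrite abel_proj.
have H_elementary p (t : seq 'I_n) : p \notin t -> t != [::] ->
    exists f theta, [/\ H f, lifts pi f theta
      & elementary p (\prod_(q <- t) 'X_q) theta].
  move=> pt t0; have [theta tE] := elementary_aut_ex K pt.
  have [i|f [Hf ft]] := lift theta
    (G_gen _ (or_intror (elementary_elementary pt tE)) _).
    have [tp tj] := tE; have [->|ip] := eqVneq i p; last first.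
      by rewrite tj //; apply: aug1_var.
    rewrite tp; apply: aug_powD; first exact: aug1_var.
    (* As [t] is nonempty, the added product has no constant term. *)
    case: t t0 {pt tE tp} => // q t _; rewrite big_cons mulrC.
    by apply: aug_powMl; apply: aug1_var.
  by exists f, theta.
have H_monomial (s : 'I_n -> 'I_n) (e : 'I_n -> K) : involutive s ->
    (forall i, e i * e (s i) = 1) ->
    exists f theta, [/\ H f, lifts pi f theta & monomial s e theta].
  move=> sK es; have [theta tE] := monomial_aut sK es.
  have [i|f [Hf ft]] := lift theta (G_gen _ (or_introl (monomial_linear tE)) _).
    by rewrite tE -mul_mpolyC; apply: aug_powMl; apply: aug1_var.
  by exists f, theta.
(* The first three variables serve as x, y and z. *)
have xy : Ordinal (ltnW (ltnW n_gt2)) != Ordinal (ltnW n_gt2) by [].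
have xz : Ordinal (ltnW (ltnW n_gt2)) != Ordinal n_gt2 by [].
have yz : Ordinal (ltnW n_gt2) != Ordinal n_gt2 by [].
have wb := free_word_basis K n.
have K2 := two_neq0 wb (@comm_proj_var K n) HM H_inj
  H_elementary H_monomial  xy xz yz.
by move: K2; rewrite (two_eq0 wb (@comm_proj_var K n) HM HV H_inj H_elementary
  H_monomial xy xz yz) eqxx.
Qed.

Theorem theorem3p1p9 (K : fieldType) (n : nat) (n_gt2 : (2 < n)%N) :
  (~ exists H : set (Aut (free_alg K n)),
       is_subgroup H /\ set_bij H (@Aut0 K n) (@abel K n)) /\
  (~ exists H : set (Aut (free_alg K n)),
       is_subgroup H /\ set_bij H (@NAut K n) (@abel K n)).
Proof.
split; apply: no_section => // theta.
  by move=> _; apply: Aut0_gen.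
by case=> [/linear_TAut|/elementary_TAut] tT _; apply: TAut_NAut.
Qed.
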